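(* Let $(X,d)$ be a compact metric space and let $(X,\mathbb{F})$ be an equicontinuous non-autonomous dynamical system generated by a commutative family $\mathbb{F}=\{f_n:n\in\mathbb{N}\}$ of homeomorphisms of $X$. If $x\in X$ is an almost periodic point, then $\overline{\mathcal{O}_H(x)}$ is uniformly almost periodic.
   Context: $\mathbb{N}=\{1,2,3,\dots\}$. The family $\mathbb{F}$ is commutative if $f_n\circ f_m=f_m\circ f_n$ for all $n,m$. The non-autonomous system $(X,\mathbb{F})$ has time-$n$ states $\omega_n(x)$, $n\in\mathbb{Z}$, defined by $\omega_0(x)=x$, $\omega_n(x)=f_n(\omega_{n-1}(x))$ for $n\ge 1$, and $\omega_n(x)=f_{-n}^{-1}(\omega_{n+1}(x))$ for $n<0$; thus $\omega_n=f_n\circ\cdots\circ f_1$ and $\omega_{-n}=f_n^{-1}\circ\cdots\circ f_1^{-1}$ for $n\geq 1$. The orbital hull of $x$ is $\mathcal{O}_H(x)=\{(\omega_{k_n}\circ\omega_{k_{n-1}}\circ\cdots\circ\omega_{k_1})(x): k_i\in\mathbb{Z},\ n\in\mathbb{N}\}$. A subset of $\mathbb{Z}$ is $M$-syndetic if it meets every set of $M$ consecutive integers, and syndetic if it is $M$-syndetic for some $M\in\mathbb{N}$. A point $x$ is almost periodic if for every $\epsilon>0$ the set $\{n\in\mathbb{Z}: d(\omega_n(x),x)<\epsilon\}$ is syndetic. A set $Y\subseteq X$ is uniformly almost periodic if for every $\epsilon>0$ there exists $M\in\mathbb{N}$ such that for every $y\in Y$ the set $\{n\in\mathbb{Z}: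 d(\omega_n(y),y)<\epsilon\}$ is $M$-syndetic. $(X,\mathbb{F})$ is equicontinuous if for each $\epsilon>0$ there exists $\delta>0$ such that for all $x,y\in X$, $d(x,y)<\delta$ implies $d(\omega_n(x),\omega_n(y))<\epsilon$ for all $n\in\mathbb{Z}$. *)

(* Defs.v *)
From HB Require Import structures.
From mathcomp Require Import all_boot all_order all_algebra.
From mathcomp Require Import all_classical all_reals all_analysis.

Set Implicit Arguments.
Unset Strict Implicit.
Unset Printing Implicit Defensive.
Import Order.TTheory GRing.Theory Num.Theory.
Local Open Scope classical_set_scope.
Local Open Scope ring_scope.

Record homeomorphism (X : topologicalType) := Homeomorphism {
  homeo_fun :> X -> X ;
  homeo_inv : X -> X ;
  homeo_funK : cancel homeo_fun homeo_inv ;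
  homeo_invK : cancel homeo_inv homeo_fun ;
  homeo_continuous : continuous homeo_fun ;
  homeo_inv_continuous : continuous homeo_inv }.

(* A family (f_n) indexed by n = 1, 2, 3, ... is encoded as a function
   f : nat -> homeomorphism X, where [f n] stands for f_(n+1). *)

Definition commutative_family (X : topologicalType)
    (f : nat -> homeomorphism X) : Prop :=
  forall n m, f n \o f m =1 f m \o f n.

Fixpoint omega_pos (X : topologicalType) (f : nat -> homeomorphism X)
    (n : nat) (x : X) : X :=
  if n is m.+1 then f m (omega_pos f m x) else x.

Fixpoint omega_neg (X : topologicalType) (f : nat -> homeomorphism X)
    (n : nat) (x : X) : X :=
  if n is m.+1 then homeo_inv (f m) (omega_neg f m x) else x.

(* [Negz n] is the integer -(n+1). *)
Definition omega (X : topologicalType) (f : nat -> homeomorphism X)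
    (k : int) (x : X) : X :=
  match k with
  | Posz n => omega_pos f n x
  | Negz n => omega_neg f n.+1 x
  end.

(* The list [:: k_1; ...; k_n] yields (omega_(k_n) \o ... \o omega_(k_1)) x. *)
Definition orbital_hull (X : topologicalType) (f : nat -> homeomorphism X)
    (x : X) : set X :=
  [set y | exists2 ks : seq int, ks != [::] &
     y = foldl (fun z k => omega f k z) x ks].

Definition M_syndetic (M : nat) (S : set int) : Prop :=
  forall a : int, exists2 k : int, a <= k < a + M%:Z & S k.

Definition syndetic (S : set int) : Prop :=
  exists2 M : nat, (0 < M)%N & M_syndetic M S.

Definition almost_periodic (R : realType) (X : metricType R)
    (f : nat -> homeomorphism X) (x : X) : Prop :=
  forall e : R, 0 < e -> syndetic [set n | mdist (omega f n x) x < e].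

Definition uniformly_almost_periodic (R : realType) (X : metricType R)
    (f : nat -> homeomorphism X) (Y : set X) : Prop :=
  forall e : R, 0 < e -> exists2 M : nat, (0 < M)%N &
    forall y, Y y -> M_syndetic M [set n | mdist (omega f n y) y < e].

Definition equicontinuous_system (R : realType) (X : metricType R)
    (f : nat -> homeomorphism X) : Prop :=
  forall e : R, 0 < e -> exists2 d : R, 0 < d &
    forall x y : X, mdist x y < d ->
      forall n : int, mdist (omega f n x) (omega f n y) < e.

(* Main.v *)
(** The maps [omega n] and the elements [g] of the group they generate commute,
    so [mdist (omega n (g x)) (g x) = mdist (g (omega n x)) (g x)], which is small as
    soon as [omega n x] is close to [x]; how close depends on [g], since the whole
    group need not be equicontinuous.  Equicontinuity of the [omega n] carries
    the estimate from [g x] over to a neighbourhood of [g x] whose size does not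
    depend on [g], and compactness of the closure of the orbital hull leaves only
    finitely many [g] to consider.  Hence a single neighbourhood of [x] works for
    all points of the closure, and the return times of [x] to it give the bound. *)
Require Import Defs.
From mathcomp Require Import all_boot all_order all_algebra.
From mathcomp Require Import all_classical all_reals all_analysis.
From mathcomp Require Import lra.
Import Order.TTheory GRing.Theory Num.Theory.
Local Open Scope classical_set_scope.
Local Open Scope ring_scope.

Lemma comp_invC (T : Type) (g g' h : T -> T) :
  cancel g g' -> cancel g' g -> g \o h =1 h \o g -> g' \o h =1 h \o g'.
Proof. by move=> gK g'K gh y /=; rewrite -[in LHS](g'K y) -[h _]gh /= gK. Qed.

Section Omega.
Variables (X : topologicalType) (f : nat -> homeomorphism X).

Lemma continuous_omega (k : int) : continuous (omega f k).
Proof.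
case: k => n; rewrite /omega; last move: n.+1 => {}n.
  elim: n => [|n IHn] y /=; first exact: cvg_id.
  by apply: continuous_comp; [exact: IHn | exact: homeo_continuous].
elim: n => [|n IHn] y /=; first exact: cvg_id.
by apply: continuous_comp; [exact: IHn | exact: homeo_inv_continuous].
Qed.

Lemma continuous_foldl_omega (ks : seq int) :
  continuous (fun y => foldl (fun z k => omega f k z) y ks).
Proof.
elim: ks => [|k ks IHks] y /=; first exact: cvg_id.
exact: (continuous_comp (continuous_omega k y) (IHks (omega f k y))).
Qed.

(** An arbitrary [h] allows two uses: with [h] some [f n], then with [h] another [omega f k]. *)
Lemma omega_comm (k : int) (h : X -> X) :
  (forall n, f n \o h =1 h \o f n) -> omega f k \o h =1 h \o omega f k.
Proof.
move=> fh; case: k => n y; rewrite /omega /comp; last move: n.+1 => {}n.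
  by elim: n => //= n ->; rewrite [LHS]fh.
elim: n => //= n ->.
exact: (comp_invC _ _ _ _ (@homeo_funK _ (f n)) (@homeo_invK _ (f n)) (fh n)).
Qed.

Hypothesis f_commutative : commutative_family f.

Lemma omega_omega (m k : int) : omega f m \o omega f k =1 omega f k \o omega f m.
Proof.
apply: omega_comm => n y.
by rewrite (@omega_comm k (f n)) // => i; exact: f_commutative.
Qed.

Lemma omega_foldl (n : int) (ks : seq int) (y : X) :
  omega f n (foldl (fun z k => omega f k z) y ks) =
  foldl (fun z k => omega f k z) (omega f n y) ks.
Proof.
by elim: ks y => //= k ks IHks y; rewrite IHks [omega f n _]omega_omega.
Qed.

End Omega.

(** Here [z] stands for [omega f n x]; quantifying [n] inside makes the neighbourhood of [x]
    independent of the time as well as of [y]. *)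
Lemma near_returns_closure_orbital_hull (R : realType) (X : metricType R)
    (f : nat -> homeomorphism X) (x : X) (e : R) :
  compact [set: X] -> equicontinuous_system f -> commutative_family f -> 0 < e ->
  \forall z \near x, forall y, closure (orbital_hull f x) y ->
    forall n, omega f n x = z -> mdist (omega f n y) y < e.
Proof.
move=> X_compact f_equi f_comm e_gt0.
have e3_gt0 : 0 < e / 3 by lra.
have [d d_gt0 dP] := f_equi _ e3_gt0.
(* The bound [d] feeds equicontinuity, [e / 3] the triangle inequality. *)
pose r := Num.min d (e / 3).
have r_gt0 : 0 < r by rewrite lt_min d_gt0.
have /compact_near_coveringP K_cover : compact (closure (orbital_hull f x)).
  by apply: (subclosed_compact _ X_compact) => //; exact: closed_closure.
apply: (K_cover X (nbhs x)
  (fun z y => forall n, omega f n x = z -> mdist (omega f n y) y < e)) => y Ky.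
have r2_gt0 : 0 < r / 2 by lra.
have [_ [[ks _ ->]]] := Ky _ (nbhsx_ballx y _ r2_gt0).
set g := fun z => foldl (fun z k => omega f k z) z ks.
rewrite -[foldl _ _ _]/(g x) ballEmdist /= => y_gx.
(* As [g] depends on [y] only, its continuity at [x] suffices. *)
exists (ball y (r / 2), g @^-1` ball (g x) (e / 3)) => /=.
  split; first exact: nbhsx_ballx.
  exact: (continuous_foldl_omega _ f ks x _ (nbhsx_ballx (g x) _ e3_gt0)).
move=> [y' z] /= []; rewrite !ballEmdist /= => y_y' gx_gz n nxz.
have y'_gx : mdist y' (g x) < r.
  apply: le_lt_trans (metric_triangle _ y _) _.
  by rewrite (metric_sym y') (splitr r) ltrD.
have [y'd y'e] : mdist y' (g x) < d /\ mdist y' (g x) < e / 3.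
  by apply/andP; rewrite -lt_min.
have ngx : omega f n (g x) = g z by rewrite /g omega_foldl // nxz.
(* Consecutive points of [omega f n y'], [g z], [g x], [y'] are within [e / 3]. *)
have := dP _ _ y'd n; rewrite ngx.
have := metric_triangle (omega f n y') (g z) y'.
have := metric_triangle (g z) (g x) y'.
rewrite (metric_sym (g z) (g x)) (metric_sym (g x) y').
lra.
Qed.

Theorem proposition7 (R : realType) (X : metricType R)
    (X_compact : compact [set: X])
    (f : nat -> homeomorphism X)
    (f_equicontinuous : equicontinuous_system f)
    (f_commutative : commutative_family f)
    (x : X) (x_almost_periodic : almost_periodic f x) :
  uniformly_almost_periodic f (closure (orbital_hull f x)).
Proof.
move=> e e_gt0.
have /nbhs_ballP[d /= d_gt0 dP] :=
  near_returns_closure_orbital_hull _ _ _ x _ X_compact f_equicontinuous f_commutative e_gt0.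
have [M M_gt0 MP] := x_almost_periodic _ d_gt0.
exists M => // y Ky a; have [k ka kd] := MP a; exists k => //.
by apply: (dP (omega f k x)) => //; rewrite ballEmdist /= metric_sym.
Qed.
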